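(* Let $k$ be an algebraically closed field of characteristic zero. Let $\Psi\colon PSL_2(\mathbf{F}_7)\to GL_3(k)$ be the faithful representation defined in the context, let $\Psi_1\colon PSL_2(\mathbf{F}_7)\to GL_4(k)$ be the faithful representation $\Psi_1(u)=\Psi(u)\oplus1$, let $\varphi_{0,1}\colon PSL_2(\mathbf{F}_7)\to PGL_4(k)$, $u\mapsto(\Psi_1(u))$, let $D=\mathrm{diag}[\sqrt{-1},\sqrt{-1},\sqrt{-1},1]$, and let $g=x^3y+y^3z+z^3x+t^4$. Then $$\mathrm{Paut}(g)=\{(AD^j): A\in\Psi_1(PSL_2(\mathbf{F}_7)),\ j\in\{0,1,2,3\}\},$$ and this group coincides with $\langle\varphi_{0,1}(PSL_2(\mathbf{F}_7)),(D)\rangle$.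
   Context: For $A\in GL_4(k)$, $(A)$ is its class in $PGL_4(k)$, $g_{A^{-1}}$ denotes the form $v\mapsto g(Av)$, and $\mathrm{Paut}(g)=\{(A)\in PGL_4(k): g_{A^{-1}}=cg\text{ for some }c\in k^*\}$. $X\oplus1$ denotes the block diagonal matrix with blocks $X$ and $1$. $PSL_2(\mathbf{F}_7)$ is generated by the classes $(a),(b),(c)$ of $a=\begin{bmatrix}1&1\\0&1\end{bmatrix}$, $b=\begin{bmatrix}5&0\\0&3\end{bmatrix}$, $c=\begin{bmatrix}0&-1\\1&0\end{bmatrix}$. Let $\varepsilon\in k^*$ have order $7$ and $\sqrt{-7}=-\varepsilon-\varepsilon^2+\varepsilon^3-\varepsilon^4+\varepsilon^5+\varepsilon^6$. $\Psi$ is the injective homomorphism with $\Psi((a))=A_3=\mathrm{diag}[\varepsilon^4,\varepsilon^2,\varepsilon]$, $$\Psi((b))=B_3=\begin{bmatrix}0&1&0\\0&0&1\\1&0&0\end{bmatrix},\qquad \Psi((c))=C_3=\frac1{\sqrt{-7}}\begin{bmatrix}\varepsilon-\varepsilon^6&\varepsilon^2-\varepsilon^5&\varepsilon^4-\varepsilon^3\\\varepsilon^2-\varepsilon^5&\varepsilon^4-\varepsilon^3&\varepsilon-\varepsilon^6\\\varepsilon^4-\varepsilon^3&\varepsilon-\varepsilon^6&\varepsilon^2-\varepsilon^5\end{bmatrix}.$$ *)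

(* Defs.v *)
From HB Require Import structures.
From mathcomp Require Import all_boot all_order all_algebra all_fingroup all_solvable.
From mathcomp Require Import generic_quotient.
From mathcomp Require Import mpoly.

Set Implicit Arguments.
Unset Strict Implicit.
Unset Printing Implicit Defensive.

Import GRing.Theory.
Local Open Scope ring_scope.
Local Open Scope quotient_scope.

(* MathComp's {'GL_n[R]} requires a finite ring; this is GL_n over any field. *)
Record GL (F : fieldType) (n : nat) :=
  MkGL { gl_mx :> 'M[F]_n; gl_unit : gl_mx \in unitmx }.

Section GLGroup.
Variables (F : fieldType) (n : nat).
Implicit Types A B : GL F n.

HB.instance Definition _ := [isSub of GL F n for @gl_mx F n].
HB.instance Definition _ := [Choice of GL F n by <:].

Fact gl_mul_unit A B : A *m B \in unitmx.
Proof. by rewrite unitmx_mul !gl_unit. Qed.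
Fact gl_one_unit : (1%:M : 'M[F]_n) \in unitmx.
Proof. exact: unitmx1. Qed.
Fact gl_inv_unit A : invmx A \in unitmx.
Proof. by rewrite unitmx_inv gl_unit. Qed.

Definition gl_mul A B := MkGL (gl_mul_unit A B).
Definition gl_one := MkGL gl_one_unit.
Definition gl_inv A := MkGL (gl_inv_unit A).

Fact gl_mulA : associative gl_mul.
Proof. by move=> A B C; apply/val_inj; rewrite /= mulmxA. Qed.
Fact gl_mul1 : left_id gl_one gl_mul.
Proof. by move=> A; apply/val_inj; rewrite /= mul1mx. Qed.
Fact gl_mulV : left_inverse gl_one gl_inv gl_mul.
Proof. by move=> A; apply/val_inj; rewrite /= mulVmx ?gl_unit. Qed.
Fact gl_mul1r : right_id gl_one gl_mul.
Proof. by move=> A; apply/val_inj; rewrite /= mulmx1. Qed.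
Fact gl_mulVr : right_inverse gl_one gl_inv gl_mul.
Proof. by move=> A; apply/val_inj; rewrite /= mulmxV ?gl_unit. Qed.

HB.instance Definition _ :=
  isGroup.Build (GL F n) gl_mulA gl_mul1 gl_mul1r gl_mulV gl_mulVr.

(* Equality modulo the subgroup of scalar matrices. *)
Definition gl_proportional A B := is_scalar_mx (A *m invmx B).

Lemma gl_proportionalP A B :
  reflect (exists2 c : F, c != 0 & (A : 'M_n) = c *: (B : 'M_n))
          (gl_proportional A B).
Proof.
apply: (iffP is_scalar_mxP) => [[c AB]|[c _ ->]]; last first.
  by exists c; rewrite -scalemxAl mulmxV ?gl_unit // scalemx1.
have AE : (A : 'M_n) = c *: (B : 'M_n).
  by rewrite -mul_scalar_mx -AB mulmxKV ?gl_unit.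
have [c0|] := eqVneq c 0; last by exists c.
exists 1; first exact: oner_neq0.
have := gl_unit A; rewrite scale1r AE c0 scale0r unitmxE.
case: n A B AB AE => [|m] A B AB AE; first by move=> _; apply/matrixP => -[].
by rewrite det0 unitr0.
Qed.

Fact gl_proportional_refl : reflexive gl_proportional.
Proof.
by move=> A; apply/gl_proportionalP; exists 1; rewrite ?oner_neq0 ?scale1r.
Qed.
Fact gl_proportional_sym : ssrbool.symmetric gl_proportional.
Proof.
move=> A B; apply/gl_proportionalP/gl_proportionalP => -[c c0 ->];
by exists c^-1; rewrite ?invr_eq0 // scalerA mulVf // scale1r.
Qed.
Fact gl_proportional_trans : transitive gl_proportional.
Proof.
move=> B A C /gl_proportionalP[c c0 AB] /gl_proportionalP[d d0 BC].
apply/gl_proportionalP; exists (c * d); first exact: mulf_neq0.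
by rewrite AB BC scalerA.
Qed.

Canonical gl_proportional_equiv :=
  EquivRel gl_proportional gl_proportional_refl gl_proportional_sym
           gl_proportional_trans.

Definition PGL := {eq_quot gl_proportional}.
HB.instance Definition _ := Choice.on PGL.
HB.instance Definition _ : EqQuotient _ gl_proportional PGL :=
  EqQuotient.on PGL.

Definition pgl_class A : PGL := \pi A.

Lemma pgl_classP A B :
  reflect (exists2 c : F, c != 0 & (A : 'M_n) = c *: (B : 'M_n))
          (pgl_class A == pgl_class B).
Proof. by rewrite /pgl_class eqquotE; apply: gl_proportionalP. Qed.

Definition pgl_mul (x y : PGL) := pgl_class (repr x * repr y)%g.
Definition pgl_one := pgl_class 1%g.
Definition pgl_inv (x : PGL) := pgl_class (repr x)^-1%g.

Lemma pgl_class_repr x : pgl_class (repr x) = x.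
Proof. exact: reprK. Qed.
Lemma repr_pgl_class A :
  exists2 c : F, c != 0 & (repr (pgl_class A) : 'M_n) = c *: (A : 'M_n).
Proof. by apply/pgl_classP; rewrite pgl_class_repr. Qed.

Lemma pgl_classM : {morph pgl_class : A B / (A * B)%g >-> pgl_mul A B}.
Proof.
move=> A B; apply/esym/eqP/pgl_classP.
have [c c0 /= ->] := repr_pgl_class A; have [d d0 /= ->] := repr_pgl_class B.
exists (c * d); first exact: mulf_neq0.
by rewrite -scalemxAl -scalemxAr scalerA.
Qed.

Lemma pgl_classV : {morph pgl_class : A / (A^-1)%g >-> pgl_inv A}.
Proof.
move=> A; apply/esym/eqP/pgl_classP.
have [c c0 /= ->] := repr_pgl_class A.
by exists c^-1; rewrite ?invr_eq0 // invmxZ // unitmxZ ?gl_unit ?unitfE.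
Qed.

Fact pgl_mulA : associative pgl_mul.
Proof.
move=> x y z; rewrite -(pgl_class_repr x) -(pgl_class_repr y).
by rewrite -(pgl_class_repr z) -!pgl_classM mulgA.
Qed.
Fact pgl_mul1 : left_id pgl_one pgl_mul.
Proof. by move=> x; rewrite -(pgl_class_repr x) -pgl_classM mul1g. Qed.
Fact pgl_mul1r : right_id pgl_one pgl_mul.
Proof. by move=> x; rewrite -(pgl_class_repr x) -pgl_classM mulg1. Qed.
Fact pgl_mulV : left_inverse pgl_one pgl_inv pgl_mul.
Proof.
by move=> x; rewrite -(pgl_class_repr x) -pgl_classV -pgl_classM mulVg.
Qed.
Fact pgl_mulVr : right_inverse pgl_one pgl_inv pgl_mul.
Proof.
by move=> x; rewrite -(pgl_class_repr x) -pgl_classV -pgl_classM mulgV.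
Qed.

HB.instance Definition _ :=
  isGroup.Build PGL pgl_mulA pgl_mul1 pgl_mul1r pgl_mulV pgl_mulVr.
HB.instance Definition _ :=
  isMultiplicative.Build (GL F n) PGL pgl_class pgl_classM.

End GLGroup.

Section Generated.
Variable G : groupType.

Definition is_subgroup (H : G -> Prop) :=
  [/\ H 1%g, forall x y, H x -> H y -> H (x * y)%g
    & forall x, H x -> H x^-1%g].

Definition generated_subgroup (S : G -> Prop) (x : G) :=
  forall H : G -> Prop, is_subgroup H -> (forall y, S y -> H y) -> H x.

End Generated.

Section Forms.
Variables (k : fieldType) (n : nat).

(* The polynomial v |-> g(A v), for column vectors v. *)
Definition form_pullback (A : 'M[k]_n) (g : {mpoly k[n]}) : {mpoly k[n]} :=
  g \mPo [tuple \sum_(j < n) A i j *: 'X_j | i < n].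

Lemma meval_form_pullback (A : 'M[k]_n) (g : {mpoly k[n]}) (v : 'cV[k]_n) :
  (form_pullback A g).@[fun i => v i 0] = g.@[fun i => (A *m v) i 0].
Proof.
rewrite comp_mpoly_meval; apply: meval_eq => i.
rewrite tnth_mktuple raddf_sum mxE /=; apply: eq_bigr => j _.
by rewrite mevalZ mevalXU.
Qed.

Definition Paut (g : {mpoly k[n]}) (x : PGL k n) :=
  exists2 A : GL k n, x = pgl_class A
    & exists2 c : k, c != 0 & form_pullback A g = c *: g.

End Forms.

Section PSL.
Variables (n : nat) (F : finFieldType).

Definition SL := [set u : {'GL_n[F]} | \det (GLval u) == 1].

Fact SL_group_set : group_set SL.
Proof.
apply/group_setP; split=> [|u v]; rewrite !inE ?det1 // => /eqP du /eqP dv.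
by rewrite det_mulmx du dv mulr1.
Qed.
Canonical SL_group := Group SL_group_set.

Definition PSL := (SL / 'Z(SL))%g.
Canonical PSL_group := [group of PSL].

Section MkPSL.
Variables (M : 'M[F]_n.-1.+1) (detM : \det M = 1).

Fact det1_unit : M \is a GRing.unit.
Proof. by rewrite -[_ \is a _]/(M \in unitmx) unitmxE detM unitr1. Qed.

Definition GL_of_det1 : {'GL_n[F]} := FinRing.unit _ det1_unit.

Fact GL_of_det1_SL : GL_of_det1 \in SL.
Proof. by rewrite inE; apply/eqP. Qed.

(* The class in PSL_n(F) of a matrix of determinant 1. *)
Definition psl_class : [subg PSL] :=
  Subg (mem_quotient 'Z(SL) GL_of_det1_SL).

End MkPSL.
End PSL.

Definition mx_of_rows (R : nzRingType) (m n : nat) (rows : seq (seq R)) :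
  'M[R]_(m, n) := \matrix_(i, j) (nth [::] rows i)`_j.

Definition diag_of_seq (R : nzRingType) (n : nat) (s : seq R) : 'M[R]_n :=
  diag_mx (\row_j s`_j).

Notation PSL27 := [subg PSL 2 'F_7].

Definition a_mx : 'M['F_7]_2 := mx_of_rows 2 2 [:: [:: 1; 1]; [:: 0; 1]].
Definition b_mx : 'M['F_7]_2 := mx_of_rows 2 2 [:: [:: 5; 0]; [:: 0; 3]].
Definition c_mx : 'M['F_7]_2 := mx_of_rows 2 2 [:: [:: 0; -1]; [:: 1; 0]].

Fact det_mx2 (R : comNzRingType) (a b c d : R) :
  \det (mx_of_rows 2 2 [:: [:: a; b]; [:: c; d]]) = a * d - b * c.
Proof.
rewrite (expand_det_row _ ord0) !big_ord_recl big_ord0 /cofactor !det_mx11.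
by rewrite !mxE /= expr0 expr1 mul1r addr0 mulN1r mulrN.
Qed.

Fact det_a : \det a_mx = 1. Proof. by rewrite det_mx2; apply/eqP. Qed.
Fact det_b : \det b_mx = 1. Proof. by rewrite det_mx2; apply/eqP. Qed.
Fact det_c : \det c_mx = 1. Proof. by rewrite det_mx2; apply/eqP. Qed.

Definition psl_a : PSL27 := @psl_class 2 'F_7 a_mx det_a.
Definition psl_b : PSL27 := @psl_class 2 'F_7 b_mx det_b.
Definition psl_c : PSL27 := @psl_class 2 'F_7 c_mx det_c.

Section Klein.
Variable k : fieldType.
Variable e : k.

Definition sqrtm7 : k := - e - e ^+ 2 + e ^+ 3 - e ^+ 4 + e ^+ 5 + e ^+ 6.

Definition A3 : 'M[k]_3 := diag_of_seq 3 [:: e ^+ 4; e ^+ 2; e].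

Definition B3 : 'M[k]_3 :=
  mx_of_rows 3 3 [:: [:: 0; 1; 0]; [:: 0; 0; 1]; [:: 1; 0; 0]].

Definition C3 : 'M[k]_3 :=
  sqrtm7^-1 *: mx_of_rows 3 3
    [:: [:: e - e ^+ 6;      e ^+ 2 - e ^+ 5; e ^+ 4 - e ^+ 3];
        [:: e ^+ 2 - e ^+ 5; e ^+ 4 - e ^+ 3; e - e ^+ 6];
        [:: e ^+ 4 - e ^+ 3; e - e ^+ 6;      e ^+ 2 - e ^+ 5]].

Definition is_Psi (Psi : PSL27 -> GL k 3) :=
  [/\ Psi psl_a = A3 :> 'M[k]_3, Psi psl_b = B3 :> 'M[k]_3
    & Psi psl_c = C3 :> 'M[k]_3].

End Klein.

Section Psi1.
Variable k : fieldType.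

Fact oplus1_unit n (X : GL k n) :
  block_mx (X : 'M_n) 0 0 (1%:M : 'M[k]_1) \in unitmx.
Proof.
by rewrite unitmxE det_lblock det1 mulr1 -unitmxE gl_unit.
Qed.

Definition oplus1 n (X : GL k n) : GL k (n + 1) := MkGL (oplus1_unit X).

Definition Psi1 (Psi : PSL27 -> GL k 3) (u : PSL27) : GL k 4 :=
  oplus1 (Psi u).

Definition phi01 (Psi : PSL27 -> GL k 3) (u : PSL27) : PGL k 4 :=
  pgl_class (Psi1 Psi u).

Section D.
Variables (i : k) (i2 : i ^+ 2 = -1).

Definition D_mx : 'M[k]_4 := diag_of_seq 4 [:: i; i; i; 1].

Fact D_unit : D_mx \in unitmx.
Proof.
have i0 : i != 0.
  by apply: contra_eq_neq i2 => ->; rewrite expr0n eq_sym oppr_eq0 oner_neq0.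
rewrite unitmxE det_diag unitfE; apply/prodf_neq0 => j _; rewrite mxE.
by case: j => -[|[|[|[|]]]] //= _; rewrite oner_neq0.
Qed.

Definition D : GL k 4 := MkGL D_unit.

End D.

Local Notation x := ('X_(@Ordinal 4 0 isT)).
Local Notation y := ('X_(@Ordinal 4 1 isT)).
Local Notation z := ('X_(@Ordinal 4 2 isT)).
Local Notation t := ('X_(@Ordinal 4 3 isT)).

Definition klein_quartic_surface : {mpoly k[4]} :=
  x ^+ 3 * y + y ^+ 3 * z + z ^+ 3 * x + t ^+ 4.

End Psi1.

(* Main.v *)
Require Import Defs.
From mathcomp Require Import all_boot all_order all_algebra all_fingroup all_solvable.
From mathcomp Require Import mpoly.
From mathcomp Require Import ring.

(* Let [f = x^3 y + y^3 z + z^3 x].  If [A] preserves [f + t^4] up to a scalar,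
   the polar of this form at the image of [(0,0,0,1)] is a multiple of the cube
   of a linear form, which forces [A] to be block diagonal; after rescaling,
   [A = X + 1] with [X] preserving [f].  Such an [X] permutes the 24 flexes of
   [f = 0] (the common zeros of [f] and its Hessian), which the coordinates
   show to form a single orbit under the image of [Psi].  So one may assume
   that [X] fixes the flex [(1,0,0)]; then [X = diag(l, l^-3, l^9)] with
   [l^28 = 1], that is, [X] is a power of [A_3] times a fourth root of unity. *)

Import GRing.Theory.

Local Open Scope ring_scope.

(** * Flexes of the Klein quartic *)

Definition klein (R : comNzRingType) (x y z : R) : R :=
  x ^+ 3 * y + y ^+ 3 * z + z ^+ 3 * x.
Arguments klein {R}.

(** The relation is oriented with the monomial [e ^+ 6] on the left, so that [ring] can use it to
    reduce modulo the seventh cyclotomic polynomial. *)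
Lemma expr6_of_cyclotomic (R : comNzRingType) (e : R) :
  1 + e + e ^+ 2 + e ^+ 3 + e ^+ 4 + e ^+ 5 + e ^+ 6 = 0 ->
  e ^+ 6 = - (1 + e + e ^+ 2 + e ^+ 3 + e ^+ 4 + e ^+ 5).
Proof. by move=> h; apply/eqP; rewrite -addr_eq0 addrC; apply/eqP. Qed.

Lemma sqrtm7_neq0 {F : fieldType} (e : F) : 7%:R != 0 :> F ->
  1 + e + e ^+ 2 + e ^+ 3 + e ^+ 4 + e ^+ 5 + e ^+ 6 = 0 -> sqrtm7 e != 0.
Proof.
move=> n7 cyc; apply: contraNneq n7 => s0; apply/eqP.
(* Up to sign [sqrtm7 e] is the quadratic Gauss sum modulo 7, whose square is -7. *)
transitivity (- (sqrtm7 e) ^+ 2); last by rewrite s0 expr0n oppr0.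
by rewrite /sqrtm7; ring: (expr6_of_cyclotomic _ _ cyc).
Qed.

(** Here [d] plays the inverse of the square root of -7. A general ring is allowed because the
    identity is applied to polynomials. *)
Lemma klein_C3 (R : comNzRingType) (e d x y z : R) :
  1 + e + e ^+ 2 + e ^+ 3 + e ^+ 4 + e ^+ 5 + e ^+ 6 = 0 ->
  d * (- e - e ^+ 2 + e ^+ 3 - e ^+ 4 + e ^+ 5 + e ^+ 6) = 1 ->
  let a := d * (e - e ^+ 6) in
  let b := d * (e ^+ 2 - e ^+ 5) in
  let c := d * (e ^+ 4 - e ^+ 3) in
  klein (a * x + b * y + c * z) (b * x + c * y + a * z)
        (c * x + a * y + b * z) = klein x y z.
Proof.
move=> /expr6_of_cyclotomic e6 ds /=.
(* This factor makes the right side homogeneous of degree 4 in [d] like the left one, leaving an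
   identity modulo the cyclotomic relation. *)
have d4 : 49%:R * d ^+ 4 = 1.
  rewrite -[RHS](expr1n _ 4).
  have <- := congr1 (fun t => t ^+ 4) ds.
  ring: e6.
rewrite -[RHS]mul1r -[in RHS]d4 /klein.
ring: e6.
Qed.

(** The Hessian determinant of the quartic divided by 54. *)
Definition klein_hessian (R : comNzRingType) (x y z : R) : R :=
  5%:R * x ^+ 2 * y ^+ 2 * z ^+ 2 - (x * y ^+ 5 + y * z ^+ 5 + z * x ^+ 5).
Arguments klein_hessian {R}.

(* On a flex with [xyz != 0] the torus-invariant function [s = x^2 y / z^3]
   determines [(x / z) ^ 7], and it is a root of a cubic. *)
Lemma flex_equations {F : fieldType} (x y z : F) :
  x != 0 -> y != 0 -> z != 0 ->
  klein x y z = 0 -> klein_hessian x y z = 0 ->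
  let s := x ^+ 2 * y / z ^+ 3 in
  (x / z) ^+ 7 = s * (s ^+ 2 + 6%:R * s - 1) /\
  s ^+ 3 + 8%:R * s ^+ 2 + 5%:R * s - 1 = 0.
Proof.
move=> x0 y0 z0 f0 h0 /=.
(* Both equations are dehomogenised to the chart [z = 1], where [s] becomes [X ^+ 2 * Y]. *)
have [X XE] : exists X, X = x / z by exists (x / z).
have [Y YE] : exists Y, Y = y / z by exists (y / z).
have X0 : X != 0 by rewrite XE mulf_neq0 ?invr_neq0.
have Y0 : Y != 0 by rewrite YE mulf_neq0 ?invr_neq0.
have -> : x ^+ 2 * y / z ^+ 3 = X ^+ 2 * Y by rewrite XE YE; field.
rewrite -XE.
have xE : x = X * z by rewrite XE divfK.
have yE : y = Y * z by rewrite YE divfK.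
have {}f0 : Y ^+ 3 = - X * (1 + X ^+ 2 * Y).
  apply/eqP; rewrite -subr_eq0; apply/eqP.
  apply: (mulIf (expf_neq0 4 z0)); rewrite mul0r -f0 /klein xE yE; ring.
have {}h0 : X ^+ 5 = 5%:R * X ^+ 2 * Y ^+ 2 - (X * Y ^+ 5 + Y).
  apply/esym/eqP; rewrite -subr_eq0; apply/eqP.
  apply: (mulIf (expf_neq0 6 z0)); rewrite mul0r -h0 /klein_hessian xE yE; ring.
have X7 : X ^+ 7 =
    X ^+ 2 * Y * ((X ^+ 2 * Y) ^+ 2 + 6%:R * (X ^+ 2 * Y) - 1).
  have -> : X ^+ 7 = X ^+ 2 * X ^+ 5 by ring.
  rewrite h0.
  have -> : Y ^+ 5 = Y ^+ 2 * Y ^+ 3 by ring.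
  rewrite f0; ring.
split=> //.
have s0 : X ^+ 2 * Y != 0 by rewrite mulf_neq0 ?expf_neq0.
apply: (mulfI s0); rewrite mulr0.
(* Substituting the formula for [X ^+ 7] here gives [s] times the cubic. *)
have : (X ^+ 2 * Y) ^+ 3 = - X ^+ 7 * (1 + X ^+ 2 * Y).
  have -> : (X ^+ 2 * Y) ^+ 3 = X ^+ 6 * Y ^+ 3 by ring.
  rewrite f0; ring.
rewrite X7 => /eqP; rewrite -subr_eq0 => /eqP <-; ring.
Qed.

(** The powers of $A_3$ leave [s] unchanged. Equal values of [s] give equal seventh powers of
    [x / z], so the two ratios differ by a seventh root of unity, which a power of $A_3$ absorbs. *)
Lemma flex_torus_orbit {F : fieldType} (e x y z x0 y0 z0 : F) :
  7.-primitive_root e ->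
  x != 0 -> y != 0 -> z != 0 -> x0 != 0 -> y0 != 0 -> z0 != 0 ->
  klein x y z = 0 -> klein_hessian x y z = 0 ->
  klein x0 y0 z0 = 0 -> klein_hessian x0 y0 z0 = 0 ->
  x ^+ 2 * y / z ^+ 3 = x0 ^+ 2 * y0 / z0 ^+ 3 ->
  exists l m, [/\ x = l * ((e ^+ 4) ^+ m * x0), y = l * ((e ^+ 2) ^+ m * y0)
    & z = l * (e ^+ m * z0)].
Proof.
move=> e7 nx ny nz nx0 ny0 nz0 f h f0 h0 s_eq.
have [X7 _] := flex_equations x y z nx ny nz f h.
have [X07 _] := flex_equations x0 y0 z0 nx0 ny0 nz0 f0 h0.
have e_n0 : e != 0.
  by apply: contra_eq_neq (prim_expr_order e7) => ->; rewrite expr0n eq_sym oner_neq0.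
have q7 : (x / z / (x0 / z0)) ^+ 7 = 1.
  have q0 : x0 / z0 != 0 by rewrite mulf_neq0 ?invr_neq0.
  by rewrite expr_div_n X7 X07 s_eq -X07 divff // expf_neq0.
have [r rE] := prim_rootP e7 q7.
(* $A_3^m$ multiplies [x / z] by [e ^+ (3 * m)], and 5 is the inverse of 3 modulo 7. *)
pose m := (5 * r)%N.
have e3m : (e ^+ m) ^+ 3 = x / z / (x0 / z0).
  rewrite rE -exprM /m [(_ * _ * _)%N](_ : _ = 7 * (2 * r) + r)%N; last by ring.
  by rewrite exprD exprM (prim_expr_order e7) expr1n mul1r.
have em7 : (e ^+ m) ^+ 7 = 1 by rewrite exprAC (prim_expr_order e7) expr1n.
have em0 : e ^+ m != 0 by rewrite expf_neq0.
exists (z / (e ^+ m * z0)), m; rewrite ![(e ^+ _) ^+ m]exprAC.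
have xE : x = (e ^+ m) ^+ 3 * z * x0 / z0 by rewrite e3m; field; rewrite nx0 nz nz0.
split; last by rewrite divfK // mulf_neq0.
  by rewrite {1}xE; field; rewrite em0 nz0.
(* Since [x] and [z] are already matched, the common value of [s] determines [y]. *)
have -> : y = x0 ^+ 2 * y0 / z0 ^+ 3 * z ^+ 3 / x ^+ 2.
  by rewrite -s_eq; field; rewrite nx nz.
have -> : x0 ^+ 2 * y0 / z0 ^+ 3 * z ^+ 3 / x ^+ 2 =
    y0 * z / (z0 * (e ^+ m) ^+ 6).
  by rewrite xE; field; rewrite nx0 nz0 nz em0.
have -> : (e ^+ m) ^+ 6 = (e ^+ m)^-1.
  by apply: (mulIf em0); rewrite mulVf // -exprSr.
by field; rewrite nz0 em0.
Qed.

(** The flexes are the three coordinate points and three orbits of seven under $A_3$, represented by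
    the columns of $C_3$ up to a scalar. The orbits correspond to the three roots of the cubic for
    [s]. *)
Lemma klein_flexP {F : fieldType} (e x y z : F) :
  7.-primitive_root e -> 7%:R != 0 :> F ->
  1 + e + e ^+ 2 + e ^+ 3 + e ^+ 4 + e ^+ 5 + e ^+ 6 = 0 ->
  klein x y z = 0 -> klein_hessian x y z = 0 ->
  let a := e - e ^+ 6 in let b := e ^+ 2 - e ^+ 5 in
  let c := e ^+ 4 - e ^+ 3 in
  [\/ [/\ y = 0 & z = 0], [/\ z = 0 & x = 0], [/\ x = 0 & y = 0] |
  exists l m, [\/
    [/\ x = l * ((e ^+ 4) ^+ m * a), y = l * ((e ^+ 2) ^+ m * b)
      & z = l * (e ^+ m * c)],
    [/\ x = l * ((e ^+ 4) ^+ m * b), y = l * ((e ^+ 2) ^+ m * c)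
      & z = l * (e ^+ m * a)] |
    [/\ x = l * ((e ^+ 4) ^+ m * c), y = l * ((e ^+ 2) ^+ m * a)
      & z = l * (e ^+ m * b)]]].
Proof.
move=> e7 n7 /expr6_of_cyclotomic e6 f h a b c.
have [x0|nx] := eqVneq x 0.
  move/eqP: f; rewrite /klein x0 expr0n /= mul0r mulr0 addr0 add0r.
  rewrite mulf_eq0 expf_eq0 /= => /orP[]/eqP ->; first by constructor 3.
  by constructor 2.
have [y0|ny] := eqVneq y 0.
  move/eqP: f; rewrite /klein y0 expr0n /= mul0r mulr0 !add0r.
  rewrite mulf_eq0 expf_eq0 /= (negPf nx) orbF => /eqP ->.
  by constructor 1.
have [z0|nz] := eqVneq z 0.
  move/eqP: f; rewrite /klein z0 expr0n /= mul0r mulr0 !addr0.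
  by rewrite mulf_eq0 expf_eq0 /= (negPf nx) (negPf ny).
constructor 4.
(* The square of [a * b * c] is -7. *)
have : a * b * c != 0.
  apply: contraNneq n7 => abc0; apply/eqP.
  transitivity (- (a * b * c) ^+ 2); last by rewrite abc0 expr0n oppr0.
  rewrite /a /b /c; ring: e6.
rewrite !mulf_eq0 !negb_or => /andP[/andP[na nb] nc].
have fa : klein a b c = 0 by rewrite /klein /a /b /c; ring: e6.
have fb : klein b c a = 0 by rewrite /klein /a /b /c; ring: e6.
have fc : klein c a b = 0 by rewrite /klein /a /b /c; ring: e6.
have ha : klein_hessian a b c = 0 by rewrite /klein_hessian /a /b /c; ring: e6.
have hb : klein_hessian b c a = 0 by rewrite /klein_hessian /a /b /c; ring: e6.
have hc : klein_hessian c a b = 0 by rewrite /klein_hessian /a /b /c; ring: e6.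
have [_] := flex_equations x y z nx ny nz f h.
set s := x ^+ 2 * y / z ^+ 3 => s_root.
(* The cubic splits over the three Gaussian periods of length two. Its roots, with cyclically
   shifted coefficients, are the values of [s] at [(a, b, c)], [(b, c, a)] and [(c, a, b)]. *)
pose t (i j l : nat) : F := i%:R * (e + e ^+ 6) + j%:R * (e ^+ 2 + e ^+ 5)
   + l%:R * (e ^+ 3 + e ^+ 4).
have /eqP : (s - t 1%N 3 4) * (s - t 4 1%N 3) * (s - t 3 4 1%N) = 0.
  rewrite -s_root /t; ring: e6.
rewrite !mulf_eq0 !subr_eq0 -orbA => /or3P[] /eqP sE.
- have [|l [m hm]] := flex_torus_orbit e x y z a b c e7 nx ny nz na nb nc f h fa ha.
    rewrite -/s sE /t; apply: (mulIf (expf_neq0 3 nc)).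
    by rewrite divfK ?expf_neq0 // /a /b /c; ring: e6.
  by exists l, m; constructor 1.
- have [|l [m hm]] := flex_torus_orbit e x y z b c a e7 nx ny nz nb nc na f h fb hb.
    rewrite -/s sE /t; apply: (mulIf (expf_neq0 3 na)).
    by rewrite divfK ?expf_neq0 // /a /b /c; ring: e6.
  by exists l, m; constructor 2.
- have [|l [m hm]] := flex_torus_orbit e x y z c a b e7 nx ny nz nc na nb f h fc hc.
    rewrite -/s sE /t; apply: (mulIf (expf_neq0 3 nb)).
    by rewrite divfK ?expf_neq0 // /a /b /c; ring: e6.
  by exists l, m; constructor 3.
Qed.

(** * The stabiliser of the quartic in GL_3 *)

Local Notation o0 := (@Ordinal 3 0 isT).
Local Notation o1 := (@Ordinal 3 1 isT).
Local Notation o2 := (@Ordinal 3 2 isT).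

Lemma ord3P (P : 'I_3 -> Prop) : P o0 -> P o1 -> P o2 -> forall i, P i.
Proof.
move=> P0 P1 P2 [[|[|[|//]]] hi].
- by rewrite (bool_irrelevance hi isT).
- by rewrite (bool_irrelevance hi isT).
- by rewrite (bool_irrelevance hi isT).
Qed.

Lemma sum_ord3 (V : nmodType) (F : 'I_3 -> V) :
  \sum_(j < 3) F j = F o0 + F o1 + F o2.
Proof.
rewrite !big_ord_recl big_ord0 addr0 addrA.
by congr (F _ + F _ + F _); apply: val_inj.
Qed.

Definition kleinv {R : comNzRingType} (v : 'cV[R]_3) : R :=
  klein (v o0 0) (v o1 0) (v o2 0).

Definition vec3 {R : comNzRingType} (x y z : R) : 'cV[R]_3 :=
  \col_i [:: x; y; z]`_i.

Definition fixes_klein {R : comNzRingType} (X : 'M[R]_3) :=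
  forall v, kleinv (X *m v) = kleinv v.

(** The derivative of the quartic at [v] in the direction [w]. *)
Definition klein_polar {R : comNzRingType} (v w : 'cV[R]_3) : R :=
  (3%:R * v o0 0 ^+ 2 * v o1 0 + v o2 0 ^+ 3) * w o0 0
  + (v o0 0 ^+ 3 + 3%:R * v o1 0 ^+ 2 * v o2 0) * w o1 0
  + (3%:R * v o2 0 ^+ 2 * v o0 0 + v o1 0 ^+ 3) * w o2 0.

(* One third of the Hessian matrix of the Klein quartic. *)
Definition klein_hessian_mx {R : comNzRingType} (v : 'cV[R]_3) : 'M[R]_3 :=
  let x := v o0 0 in let y := v o1 0 in let z := v o2 0 in
  mx_of_rows 3 3 [:: [:: 2%:R * x * y; x ^+ 2; z ^+ 2];
    [:: x ^+ 2; 2%:R * y * z; y ^+ 2]; [:: z ^+ 2; y ^+ 2; 2%:R * z * x]].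

Lemma det_mx3 (R : comNzRingType) (M : 'M[R]_3) :
  \det M = M o0 o0 * (M o1 o1 * M o2 o2 - M o1 o2 * M o2 o1)
    - M o0 o1 * (M o1 o0 * M o2 o2 - M o1 o2 * M o2 o0)
    + M o0 o2 * (M o1 o0 * M o2 o1 - M o1 o1 * M o2 o0).
Proof.
rewrite (expand_det_row _ o0) sum_ord3 /cofactor.
have det2 (N : 'M[R]_2) : \det N = N 0 0 * N 1 1 - N 0 1 * N 1 0.
  rewrite (expand_det_row _ ord0) !big_ord_recl big_ord0 /cofactor !det_mx11.
  rewrite !mxE /= expr0 expr1 mul1r addr0 mulN1r mulrN.
  by congr (N _ _ * N _ _ - N _ _ * N _ _); apply: val_inj.
rewrite !det2 !mxE /=.
have -> : lift o0 0 = o1 by apply: val_inj.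
have -> : lift o0 1 = o2 by apply: val_inj.
have -> : lift o1 0 = o0 by apply: val_inj.
have -> : lift o1 1 = o2 by apply: val_inj.
have -> : lift o2 0 = o0 by apply: val_inj.
have -> : lift o2 1 = o1 by apply: val_inj.
ring.
Qed.

Lemma det_klein_hessian_mx (R : comNzRingType) (v : 'cV[R]_3) :
  \det (klein_hessian_mx v) = 2%:R * klein_hessian (v o0 0) (v o1 0) (v o2 0).
Proof. rewrite det_mx3 !mxE /= /klein_hessian; ring. Qed.

(** The odd part of the quartic along [v + t w] has only terms in [t] and [t ^+ 3]. Combining its
    values at [t = 1] and [t = 2] with weights 8 and -1 eliminates the cubic term, so the polar is
    expressed by values that a linear map can transport. *)
Lemma klein_polarE (R : comNzRingType) (v w : 'cV[R]_3) :
  12%:R * klein_polar v w = 8%:R * (kleinv (v + w) - kleinv (v - w))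
    - (kleinv (v + (w + w)) - kleinv (v - (w + w))).
Proof. rewrite /klein_polar /kleinv /klein !mxE; ring. Qed.

(** Twice the coefficient of [t ^+ 2] in the quartic along [v + t w], that is, the quadratic form of
    the full Hessian matrix at [v]. Polarising it recovers the bilinear form. *)
Definition klein_second_difference {R : comNzRingType} (v w : 'cV[R]_3) : R :=
  kleinv (v + w) + kleinv (v - w) - 2%:R * kleinv v - 2%:R * kleinv w.

Lemma klein_hessian_mxE (R : comNzRingType) (v u w : 'cV[R]_3) :
  6%:R * (u^T *m klein_hessian_mx v *m w) 0 0 =
    klein_second_difference v (u + w) - klein_second_difference v u
    - klein_second_difference v w.
Proof.
rewrite mxE sum_ord3 !mxE !sum_ord3 !mxE /=.
rewrite /klein_second_difference /kleinv /klein !mxE; ring.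
Qed.

Lemma fixes_klein_polar {F : fieldType} (X : 'M[F]_3) (v w : 'cV[F]_3) :
  12%:R != 0 :> F -> fixes_klein X ->
  klein_polar (X *m v) (X *m w) = klein_polar v w.
Proof.
move=> n12 hX; apply: (mulfI n12); rewrite !klein_polarE.
by rewrite -!(mulmxDr, mulmxBr) !hX.
Qed.

Lemma fixes_klein_hessian {F : fieldType} (X : 'M[F]_3) (v : 'cV[F]_3) :
  6%:R != 0 :> F -> fixes_klein X ->
  X^T *m klein_hessian_mx (X *m v) *m X = klein_hessian_mx v.
Proof.
move=> n6 hX; apply/matrixP => i j.
have entry (M : 'M[F]_3) :
    M i j = ((delta_mx i 0 : 'cV_3)^T *m M *m (delta_mx j 0 : 'cV_3)) 0 0.
  by rewrite trmx_delta -rowE -colE !mxE.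
rewrite entry [RHS]entry !mulmxA -trmx_mul -mulmxA.
apply: (mulfI n6); rewrite !klein_hessian_mxE /klein_second_difference.
by rewrite -!(mulmxDr, mulmxBr) !hX.
Qed.

(** The first column of [X] is the image of the flex (1,0,0). The congruence of Hessian matrices
    multiplies their determinants by the nonzero square of [\det X], so vanishing is preserved. *)
Lemma fixes_klein_flex {F : fieldType} (X : 'M[F]_3) :
  6%:R != 0 :> F -> X \in unitmx -> fixes_klein X ->
  klein (X o0 o0) (X o1 o0) (X o2 o0) = 0 /\
  klein_hessian (X o0 o0) (X o1 o0) (X o2 o0) = 0.
Proof.
move=> n6 uX hX.
have XE i : X i o0 = (X *m vec3 1 0 0) i 0.
  by rewrite mxE sum_ord3 !mxE /= mulr1 !mulr0 !addr0.
rewrite !XE; split.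
  rewrite -/(kleinv _) hX /kleinv /klein !mxE /=; ring.
have n2 : 2%:R != 0 :> F.
  apply: contraNneq n6 => n20; apply/eqP.
  have -> : 6%:R = 2%:R * 3%:R :> F by ring.
  by rewrite n20 mul0r.
apply: (mulfI n2); rewrite mulr0 -det_klein_hessian_mx.
have dX : \det X != 0 by rewrite -unitfE -unitmxE.
apply: (mulfI dX); apply: (mulIf dX); rewrite mulr0 mul0r.
rewrite -{1}det_tr -!det_mulmx fixes_klein_hessian // det_klein_hessian_mx.
rewrite /klein_hessian !mxE /=; ring.
Qed.

(** The polars at the coordinate points are multiples of coordinate forms, so comparing them on
    basis vectors kills the off-diagonal entries one after another. The diagonal [(l, m, s)] then
    satisfies [l^3 m = m^3 s = s^3 l = 1], and [l ^+ 25] is the inverse of [l ^+ 3]. *)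
Lemma fixes_klein_diag {F : fieldType} (X : 'M[F]_3) :
  12%:R != 0 :> F -> X \in unitmx -> fixes_klein X ->
  X o1 o0 = 0 -> X o2 o0 = 0 ->
  exists2 l, l ^+ 28 = 1 & X = diag_of_seq 3 [:: l; l ^+ 25; l ^+ 9].
Proof.
move=> n12 uX hX X10 X20.
have XE j i : (X *m delta_mx j 0 : 'cV_3) i 0 = X i j by rewrite -colE mxE.
have pol v w := fixes_klein_polar X v w n12 hX.
have polE j l := pol (delta_mx j 0) (delta_mx l 0).
have nl : X o0 o0 != 0.
  apply: contraTneq uX => X00; rewrite unitmxE det_mx3 X00 X10 X20.
  by rewrite !(mul0r, mulr0, subr0, addr0) unitr0.
have := polE o0 o0; have := polE o0 o1; have := polE o0 o2.
rewrite /klein_polar !XE !mxE /= X10 X20.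
rewrite !(expr0n, expr1n, mulr0, mul0r, mulr1, addr0, add0r, mul1r) /=.
move=> /eqP; rewrite mulf_eq0 expf_eq0 (negPf nl) andbF /= => /eqP X12.
move=> l3m _.
have ns : X o2 o2 != 0.
  apply: contraTneq uX => X22; rewrite unitmxE det_mx3 X12 X10 X20 X22.
  by rewrite !(mul0r, mulr0, subr0, addr0) unitr0.
(* The quartic vanishes at (0,0,1), hence at its image, where only the term [z^3 x] is left. *)
have X02 : X o0 o2 = 0.
  have := hX (delta_mx o2 0); rewrite /kleinv /klein !XE !mxE /= X12.
  rewrite !(expr0n, mulr0, mul0r, addr0, add0r) /=.
  by move=> /eqP; rewrite mulf_eq0 expf_eq0 (negPf ns) => /eqP.
have := polE o2 o0; have := polE o2 o1.
rewrite /klein_polar !XE !mxE /= X12 X02 X10 X20.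
rewrite !(expr0n, expr1n, mulr0, mul0r, mulr1, addr0, add0r, mul1r) /=.
move=> /eqP; rewrite mulf_eq0 expf_eq0 (negPf ns) andbF /= => /eqP X01.
move=> s3l.
have := polE o1 o0; have := polE o1 o2.
rewrite /klein_polar !XE !mxE /= X12 X02 X10 X20 X01.
rewrite !(expr0n, expr1n, mulr0, mul0r, mulr1, addr0, add0r, mul1r) /=.
move=> m3s /eqP; rewrite mulf_eq0 expf_eq0 (negPf nl) orbF /= => /eqP X21.
have sE : X o2 o2 = X o0 o0 ^+ 9.
  rewrite -[RHS]mul1r -m3s -[LHS]mul1r -[in LHS](expr1n _ 3) -l3m; ring.
have l28 : X o0 o0 ^+ 28 = 1 by rewrite -s3l sE -exprM -exprSr.
exists (X o0 o0) => //.
have mE : X o1 o1 = X o0 o0 ^+ 25.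
  by rewrite -[LHS]mul1r -l28 -[RHS]mulr1 -l3m; ring.
apply/matrixP; apply: ord3P; apply: ord3P; rewrite !mxE //=.
Qed.

(** * Reduction from four to three variables *)

Local Notation p0 := (@Ordinal 4 0 isT).
Local Notation p1 := (@Ordinal 4 1 isT).
Local Notation p2 := (@Ordinal 4 2 isT).
Local Notation p3 := (@Ordinal 4 3 isT).

Lemma ord4P (P : 'I_4 -> Prop) : P p0 -> P p1 -> P p2 -> P p3 -> forall i, P i.
Proof.
move=> P0 P1 P2 P3 [[|[|[|[|//]]]] hi].
- by rewrite (bool_irrelevance hi isT).
- by rewrite (bool_irrelevance hi isT).
- by rewrite (bool_irrelevance hi isT).
- by rewrite (bool_irrelevance hi isT).
Qed.

Lemma sum_ord4 (V : nmodType) (F : 'I_4 -> V) :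
  \sum_(j < 4) F j = F p0 + F p1 + F p2 + F p3.
Proof.
rewrite !big_ord_recl big_ord0 addr0 !addrA.
by congr (F _ + F _ + F _ + F _); apply: val_inj.
Qed.

Definition surfacev {R : comNzRingType} (v : 'cV[R]_4) : R :=
  klein (v p0 0) (v p1 0) (v p2 0) + v p3 0 ^+ 4.

Definition vec4 {R : comNzRingType} (x y z t : R) : 'cV[R]_4 :=
  \col_i [:: x; y; z; t]`_i.

Definition surface_polar {R : comNzRingType} (v w : 'cV[R]_4) : R :=
  (3%:R * v p0 0 ^+ 2 * v p1 0 + v p2 0 ^+ 3) * w p0 0
  + (v p0 0 ^+ 3 + 3%:R * v p1 0 ^+ 2 * v p2 0) * w p1 0
  + (3%:R * v p2 0 ^+ 2 * v p0 0 + v p1 0 ^+ 3) * w p2 0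
  + 4%:R * v p3 0 ^+ 3 * w p3 0.

Lemma surface_polarE (R : comNzRingType) (v w : 'cV[R]_4) :
  12%:R * surface_polar v w = 8%:R * (surfacev (v + w) - surfacev (v - w))
    - (surfacev (v + (w + w)) - surfacev (v - (w + w))).
Proof. rewrite /surface_polar /surfacev /klein !mxE; ring. Qed.

(* The polar of the surface at the image of [(0,0,0,1)] is a multiple of the
   cube of a linear form; this forces that image to be [(0,0,0,1)] again. *)
Lemma surface_semi_invariant_block {F : fieldType} (A : 'M[F]_4) (c : F) :
  12%:R != 0 :> F -> A \in unitmx -> c != 0 ->
  (forall v, surfacev (A *m v) = c * surfacev v) ->
  [/\ A p0 p3 = 0, A p1 p3 = 0 & A p2 p3 = 0] /\
  [/\ A p3 p0 = 0, A p3 p1 = 0 & A p3 p2 = 0].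
Proof.
move=> n12 uA c0 hA.
have n6 : 6%:R != 0 :> F.
  apply: contraNneq n12 => n; apply/eqP.
  have -> : 12%:R = 2%:R * 6%:R :> F by ring.
  by rewrite n mulr0.
have n4 : 4%:R != 0 :> F.
  apply: contraNneq n12 => n; apply/eqP.
  have -> : 12%:R = 3%:R * 4%:R :> F by ring.
  by rewrite n mulr0.
have n3 : 3%:R != 0 :> F.
  apply: contraNneq n12 => n; apply/eqP.
  have -> : 12%:R = 4%:R * 3%:R :> F by ring.
  by rewrite n mulr0.
have pol v w : surface_polar (A *m v) (A *m w) = c * surface_polar v w.
  apply: (mulfI n12); rewrite mulrCA !surface_polarE.
  by rewrite -!(mulmxDr, mulmxBr) !hA; ring.
set L := invmx A.
(* The polar is taken at the preimage of [(x, y, z, t)] in the direction (0,0,0,1). The left side is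
   linear in the last column of [A], and the right side is the cube of the linear form given by the
   last row of [L]. *)
have key x y z t :
    (3%:R * x ^+ 2 * y + z ^+ 3) * A p0 p3
    + (x ^+ 3 + 3%:R * y ^+ 2 * z) * A p1 p3
    + (3%:R * z ^+ 2 * x + y ^+ 3) * A p2 p3 + 4%:R * t ^+ 3 * A p3 p3
    = 4%:R * c * (L p3 p0 * x + L p3 p1 * y + L p3 p2 * z + L p3 p3 * t) ^+ 3.
  have := pol (L *m vec4 x y z t) (delta_mx p3 0).
  rewrite mulmxA mulmxV // mul1mx -colE /surface_polar !mxE /= !sum_ord4.
  by rewrite !mxE /= => ->; ring.
have K0 : 4%:R * c != 0 by rewrite mulf_neq0.
have kx := key 1 0 0 0; have ky := key 0 1 0 0; have kz := key 0 0 1 0.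
have kxy := key 1 1 0 0; have kxz := key 1 0 1 0; have kyz := key 0 1 1 0.
have kxyz := key 1 1 1 0.
rewrite !(expr0n, expr1n, mulr0, mul0r, mulr1, mul1r, addr0, add0r) /=
  in kx ky kz kxy kxz kyz kxyz.
(* The left side of [key] has no monomial [xyz]; inclusion-exclusion over the 0-1 points extracts
   this coefficient from the cube. *)
have xyz : L p3 p0 * L p3 p1 * L p3 p2 = 0.
  apply: (mulfI (mulf_neq0 n6 K0)); rewrite mulr0.
  have -> : 6%:R * (4%:R * c) * (L p3 p0 * L p3 p1 * L p3 p2) =
    4%:R * c * (L p3 p0 + L p3 p1 + L p3 p2) ^+ 3
    - 4%:R * c * (L p3 p0 + L p3 p1) ^+ 3 - 4%:R * c * (L p3 p0 + L p3 p2) ^+ 3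
    - 4%:R * c * (L p3 p1 + L p3 p2) ^+ 3 + 4%:R * c * L p3 p0 ^+ 3
    + 4%:R * c * L p3 p1 ^+ 3 + 4%:R * c * L p3 p2 ^+ 3 by ring.
  rewrite -kxyz -kxy -kxz -kyz -kx -ky -kz; ring.
have cube0 l : 4%:R * c * l ^+ 3 = 0 -> l = 0.
  by move=> /eqP; rewrite mulf_eq0 (negPf K0) expf_eq0 => /eqP.
(* By [kz], [kx], [ky] the entries of the last column of [A] are multiples of the cubes of
   [L p3 p2], [L p3 p0], [L p3 p1]. The values at points with two ones therefore pass the vanishing
   of one coefficient on to the next. *)
have L0 : L p3 p0 = 0.
  have L10 : L p3 p1 = 0 -> L p3 p0 = 0.
    move=> L1; apply: cube0; rewrite -kx; apply: (mulfI n3); rewrite mulr0.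
    have A2 : A p2 p3 = 0 by rewrite ky L1 expr0n mulr0.
    move: kyz; rewrite L1 add0r -kz A2 addr0.
    by move=> /(canRL (addKr _)); rewrite addNr.
  move/eqP: xyz; rewrite !mulf_eq0 -orbA => /or3P[] /eqP // L2; apply: L10.
  apply: cube0; rewrite -ky; apply: (mulfI n3); rewrite mulr0.
  have A0 : A p0 p3 = 0 by rewrite kz L2 expr0n mulr0.
  move: kxz; rewrite L2 addr0 -kx A0 add0r.
  by move=> /(canRL (addKr _)); rewrite addNr.
have A1 : A p1 p3 = 0 by rewrite kx L0 expr0n mulr0.
have A0 : A p0 p3 = 0.
  apply: (mulfI n3); rewrite mulr0.
  move: kxy; rewrite L0 add0r -ky A1 addr0.
  by move=> /(canRL (addrK _)); rewrite subrr.
have L2 : L p3 p2 = 0 by apply: cube0; rewrite -kz.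
have A2 : A p2 p3 = 0.
  apply: (mulfI n3); rewrite mulr0.
  by move: kxz; rewrite L0 L2 A0 A1 !add0r expr0n mulr0.
have L1 : L p3 p1 = 0 by apply: cube0; rewrite -ky.
split=> //.
(* Only the last entry of the last row of [L] survives, so the last row of [L *m A = 1] determines
   that of [A]. *)
have LA j : L p3 p3 * A p3 j = (p3 == j)%:R.
  have : (L *m A) p3 j = (p3 == j)%:R by rewrite mulVmx // mxE.
  by rewrite mxE sum_ord4 L0 L1 L2 !mul0r !add0r.
have nL : L p3 p3 != 0.
  by apply: contra_eq_neq (LA p3) => ->; rewrite mul0r eq_sym oner_neq0.
by split; apply: (mulfI nL); rewrite mulr0 LA.
Qed.

(** One has [l = l ^+ 21 * l ^+ 8], a fourth root of unity times a seventh root of unity. *)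
Lemma root_unity28 {F : fieldType} (e i l : F) :
  7.-primitive_root e -> i ^+ 2 = -1 -> l ^+ 28 = 1 ->
  exists (j : 'I_4) m, l = i ^+ j * (e ^+ 4) ^+ m.
Proof.
move=> e7 i2 l28.
have i4 : i ^+ 4 = 1 by rewrite (exprM i 2 2) i2 sqrrN expr1n.
have l56 : (l ^+ 8) ^+ 7 = 1 by rewrite -exprM (exprM l 28 2) l28 expr1n.
have [r rE] := prim_rootP e7 l56.
have [j jE] : exists j : 'I_4, l ^+ 21 = i ^+ j.
  have : (l ^+ 21 - 1) * (l ^+ 21 - i) * (l ^+ 21 + 1) * (l ^+ 21 + i) = 0.
    transitivity ((l ^+ 28) ^+ 3 - 1); last by rewrite l28 expr1n subrr.
    by ring: i2.
  move=> /eqP; rewrite !mulf_eq0 !subr_eq0 !addr_eq0 -!orbA.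
  case/or4P => /eqP ->.
  - by exists (@Ordinal 4 0 isT).
  - by exists (@Ordinal 4 1 isT).
  - by exists (@Ordinal 4 2 isT).
  - by exists (@Ordinal 4 3 isT); rewrite /= exprS i2 mulrN1.
(* 2 is the inverse of 4 modulo 7. *)
exists j, (2 * r)%N.
rewrite -exprM (_ : (4 * (2 * r) = 7 * r + r)%N); last by ring.
rewrite exprD exprM (prim_expr_order e7) expr1n mul1r -jE -rE -exprD.
by rewrite -[LHS]mul1r -l28 -exprSr.
Qed.

(** * Generators of PSL_2(F_7) *)

Lemma psl_class_eq (n : nat) (F : finFieldType) (M N : 'M[F]_n.-1.+1)
    (dM : \det M = 1) (dN : \det N = 1) :
  M = N -> psl_class dM = psl_class dN.
Proof. by move=> MN; case: N / MN dN => dN; rewrite (eq_irrelevance dM dN). Qed.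

Lemma det1_mulmx {R : comNzRingType} {n : nat} {M N : 'M[R]_n} :
  \det M = 1 -> \det N = 1 -> \det (M *m N) = 1.
Proof. by move=> dM dN; rewrite det_mulmx dM dN mulr1. Qed.

Lemma SL_in_normaliser {n : nat} {F : finFieldType} {u : {'GL_n[F]}} :
  u \in SL n F -> u \in ('N('Z(SL n F)))%g.
Proof. exact: (subsetP (normal_norm (center_normal _))). Qed.

Lemma psl_classM (n : nat) (F : finFieldType) (M N : 'M[F]_n.-1.+1)
    (dM : \det M = 1) (dN : \det N = 1) :
  psl_class (det1_mulmx dM dN) = (psl_class dM * psl_class dN)%g.
Proof.
apply: val_inj => /=.
rewrite -morphM ?SL_in_normaliser ?GL_of_det1_SL //.
by congr (coset _ _); apply: val_inj.
Qed.

Lemma psl_class_surj (n : nat) (F : finFieldType) (u : [subg PSL n F]) :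
  exists (M : 'M[F]_n.-1.+1) (dM : \det M = 1), u = psl_class dM.
Proof.
have /morphimP[g _ gSL uE] : sgval u \in PSL n F by apply: subgP.
have dg : \det (GLval g) = 1 by move: gSL; rewrite inE => /eqP.
exists (GLval g), dg; apply: val_inj; rewrite /= uE.
by congr (coset _ _); apply: val_inj.
Qed.

Definition mx2 {R : nzRingType} (a b c d : R) : 'M[R]_2 :=
  mx_of_rows 2 2 [:: [:: a; b]; [:: c; d]].

Lemma mx2_eta {R : nzRingType} (M : 'M[R]_2) :
  M = mx2 (M 0 0) (M 0 1) (M 1 0) (M 1 1).
Proof.
apply/matrixP => -[[|[|//]] hi] [[|[|//]] hj]; rewrite !mxE /=;
by congr (M _ _); apply: val_inj.
Qed.

Lemma mulmx2 {R : comNzRingType} (a b c d a' b' c' d' : R) :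
  mx2 a b c d *m mx2 a' b' c' d' =
  mx2 (a * a' + b * c') (a * b' + b * d') (c * a' + d * c') (c * b' + d * d').
Proof.
apply/matrixP => -[[|[|//]] hi] [[|[|//]] hj];
by rewrite !mxE !big_ord_recl big_ord0 !mxE /= addr0.
Qed.

(* Bruhat decomposition; 5 generates the multiplicative group of F_7, so the
   powers of b already form the whole diagonal torus. *)
Lemma psl27_generated (H : PSL27 -> Prop) :
  (forall u v, H u -> H v -> H (u * v)%g) ->
  H 1%g -> H psl_a -> H psl_b -> H psl_c -> forall u, H u.
Proof.
move=> HM H1 Ha Hb Hc u; have [M [dM ->]] := psl_class_surj 2 'F_7 u.
(* Quantifying over the proof of [\det N = 1] lets [G] be rewritten along equalities of matrices. *)
pose G (N : 'M['F_7]_2) := forall d : \det N = 1, H (@psl_class 2 'F_7 N d).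
have GM N N' (dN : \det N = 1) (dN' : \det N' = 1) : G N -> G N' -> G (N *m N').
  move=> hN hN' d; rewrite (psl_class_eq 2 'F_7 _ _ d (det1_mulmx dN dN') erefl).
  by rewrite (psl_classM 2 'F_7); apply: HM.
have G1 : G (mx2 1 0 0 1).
  move=> d; rewrite (_ : @psl_class 2 'F_7 _ d = 1%g) //; apply: val_inj => /=.
  rewrite -(morph1 (coset_morphism 'Z(SL 2 'F_7)%g)) /=.
  congr (coset _ _); apply: val_inj; apply/matrixP => -[[|[|//]] hi] [[|[|//]] hj];
  by rewrite !mxE.
have Ga : G a_mx by move=> d; rewrite (psl_class_eq 2 'F_7 _ _ d det_a erefl).
have Gb : G b_mx by move=> d; rewrite (psl_class_eq 2 'F_7 _ _ d det_b erefl).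
have Gc : G c_mx by move=> d; rewrite (psl_class_eq 2 'F_7 _ _ d det_c erefl).
have dU (x : 'F_7) : \det (mx2 1 x 0 1) = 1 by rewrite det_mx2 mulr0 subr0 mulr1.
have GU (x : 'F_7) : G (mx2 1 x 0 1).
  rewrite -(natr_Zp x); elim: (x : nat) => [|n IHn] //.
  have -> : mx2 1 n.+1%:R 0 1 = a_mx *m mx2 1 n%:R 0 1 :> 'M['F_7]_2.
    by rewrite mulmx2 !(mulr0, mulr1, mul0r, mul1r, addr0, add0r) natr1.
  exact: GM det_a (dU _) Ga IHn.
have dT (x y : 'F_7) : x * y = 1 -> \det (mx2 x 0 0 y) = 1.
  by move=> xy; rewrite det_mx2 mulr0 subr0.
have e53 j : (5%:R : 'F_7) ^+ j * 3%:R ^+ j = 1.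
  by rewrite -exprMn (_ : 5%:R * 3%:R = 1) ?expr1n //; apply/eqP.
have GT (x y : 'F_7) : x * y = 1 -> G (mx2 x 0 0 y).
  move=> xy.
  (* The witnesses are the discrete logarithms of 1, ..., 6 to base 5. *)
  have [j xj] : exists j, x = 5%:R ^+ j.
    have x0 : x != 0 by apply: contra_eq_neq xy => ->; rewrite mul0r eq_sym oner_neq0.
    case: x x0 {xy} => -[|[|[|[|[|[|[|//]]]]]]] hx // _;
      [exists 0%N|exists 4|exists 5|exists 2|exists 1%N|exists 3]; exact/eqP.
  have -> : y = 3%:R ^+ j.
    by rewrite -[LHS]mul1r -[X in X * y](e53 j) mulrAC -xj xy mul1r.
  rewrite xj; elim: j {xj} => [|j IHj] //.
  have -> : mx2 (5%:R ^+ j.+1) 0 0 (3%:R ^+ j.+1) =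
      b_mx *m mx2 (5%:R ^+ j) 0 0 (3%:R ^+ j) :> 'M['F_7]_2.
    by rewrite mulmx2 !(mulr0, mulr1, mul0r, mul1r, addr0, add0r) -!exprS.
  exact: GM det_b (dT _ _ (e53 j)) Gb IHj.
suff : G M by apply.
move: dM; rewrite (mx2_eta M).
move: (M 0 0) (M 0 1) (M 1 0) (M 1 1) => p q r s.
rewrite det_mx2; have [->|r0] := eqVneq r 0.
  rewrite mulr0 subr0 => ps.
  have -> : mx2 p q 0 s = mx2 1 (q * p) 0 1 *m mx2 p 0 0 s.
    rewrite mulmx2 -(mulrA q p s) ps.
    by rewrite !(mulr0, mulr1, mul0r, mul1r, addr0, add0r).
  by apply: GM (GU _) (GT _ _ ps) => //; apply: dT.
move=> d1.
have rr : r^-1 * r = 1 by rewrite mulVf.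
(* The big cell: a unipotent, a diagonal matrix, [c_mx] and another unipotent. *)
have -> : mx2 p q r s =
    mx2 1 (p / r) 0 1 *m (mx2 r^-1 0 0 r *m (c_mx *m mx2 1 (s / r) 0 1)).
  rewrite !mulmx2 !(mulr0, mulr1, mul0r, mul1r, addr0, add0r).
  have -> : q = (p * s - 1) / r by rewrite -d1 opprB addrC subrK mulfK.
  congr mx2; field; exact: r0.
have dc := det1_mulmx det_c (dU (s / r)).
have dtc := det1_mulmx (dT _ _ rr) dc.
have Gcu := GM _ _ det_c (dU (s / r)) Gc (GU _).
exact: GM (dU _) dtc (GU _) (GM _ _ (dT _ _ rr) dc (GT _ _ rr) Gcu).
Qed.

(** * Pullbacks of the quaternary form *)

(** Pullback is contravariant. The identity is proved between polynomials, on each variable of each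
    monomial, so it does not depend on the size of the field. *)
Lemma form_pullback_mul {k : fieldType} {n : nat} (A B : 'M[k]_n)
    (p : {mpoly k[n]}) :
  form_pullback (A *m B) p = form_pullback B (form_pullback A p).
Proof.
rewrite /form_pullback [p \mPo _]comp_mpolyEX (comp_mpolyEX p) raddf_sum /=.
apply: eq_bigr => m _; rewrite comp_mpolyZ !comp_mpolyX rmorph_prod /=.
congr (_ *: _); apply: eq_bigr => i _; rewrite rmorphXn /= !tnth_mktuple.
congr (_ ^+ _); rewrite raddf_sum /=.
under [RHS]eq_bigr => j _.
  rewrite comp_mpolyZ comp_mpolyXU -tnth_nth tnth_mktuple scaler_sumr.
  under eq_bigr do rewrite scalerA.
  over.
rewrite exchange_big /=; apply: eq_bigr => l _.
by rewrite mxE scaler_suml.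
Qed.

Lemma form_pullbackZ {k : fieldType} {n : nat} (A : 'M[k]_n) (c : k)
    (p : {mpoly k[n]}) :
  form_pullback A (c *: p) = c *: form_pullback A p.
Proof. exact: comp_mpolyZ. Qed.

Lemma form_pullback1 {k : fieldType} {n : nat} (p : {mpoly k[n]}) :
  form_pullback 1%:M p = p.
Proof.
rewrite -[RHS]comp_mpoly_id /form_pullback; congr (_ \mPo _).
apply: eq_from_tnth => i; rewrite !tnth_mktuple (bigD1 i) //= mxE eqxx scale1r.
by rewrite big1 ?addr0 // => j ji; rewrite mxE eq_sym (negPf ji) scale0r.
Qed.

Lemma form_pullback_klein {k : fieldType} (A : 'M[k]_4) :
  let L i := \sum_(j < 4) A i j *: 'X_j : {mpoly k[4]} in
  form_pullback A (klein_quartic_surface k) =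
    klein (L p0) (L p1) (L p2) + L p3 ^+ 4.
Proof.
move=> L; rewrite /klein_quartic_surface /form_pullback /klein.
rewrite !(rmorphD, rmorphM, rmorphXn) /= !comp_mpolyXU.
pose T := [tuple L i | i < 4].
have TE (j : 'I_4) : T`_j = L j by rewrite -tnth_nth tnth_mktuple.
by rewrite -/T (TE p0) (TE p1) (TE p2) (TE p3).
Qed.

Lemma meval_klein {k : fieldType} (v : 'cV[k]_4) :
  (klein_quartic_surface k).@[fun i => v i 0] = surfacev v.
Proof.
by rewrite /klein_quartic_surface !(mevalD, mevalM, rmorphXn) /= !mevalXU.
Qed.

Lemma surfacev_pullback {k : fieldType} (A : 'M[k]_4) (c : k) (v : 'cV[k]_4) :
  form_pullback A (klein_quartic_surface k) = c *: klein_quartic_surface k ->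
  surfacev (A *m v) = c * surfacev v.
Proof. by move=> hA; rewrite -!meval_klein -meval_form_pullback hA mevalZ. Qed.

(** This translates between block decompositions over ['I_(3 + 1)] and the explicit indices of
    ['I_4]. *)
Lemma oplus1_block {k : fieldType} (X : 'M[k]_3) (A : 'M[k]_(3 + 1)) :
  A = block_mx X 0 0 (1%:M : 'M_1) <->
  [/\ forall i j : 'I_3, A (lshift 1 i) (lshift 1 j) = X i j,
      forall i, A (lshift 1 i) p3 = 0, forall j, A p3 (lshift 1 j) = 0
    & A p3 p3 = 1].
Proof.
have p3E : p3 = rshift 3 ord0 :> 'I_(3 + 1) by apply: val_inj.
split=> [->|[hX h0 h0' h1]].
  split=> [i j|i|j|]; rewrite ?p3E.
  - exact: block_mxEul.
  - by rewrite block_mxEur mxE.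
  - by rewrite block_mxEdl mxE.
  - by rewrite block_mxEdr mxE.
apply/matrixP => i j.
case: (split_ordP i) => {}i ->; case: (split_ordP j) => {}j ->.
- by rewrite block_mxEul hX.
- by rewrite block_mxEur mxE !ord1 -p3E h0.
- by rewrite block_mxEdl mxE !ord1 -p3E h0'.
- by rewrite block_mxEdr mxE !ord1 -p3E h1.
Qed.

Lemma ord4_shift :
  [/\ p0 = lshift 1 o0 :> 'I_(3 + 1), p1 = lshift 1 o1 :> 'I_(3 + 1)
    & p2 = lshift 1 o2 :> 'I_(3 + 1)].
Proof. by split; apply: val_inj. Qed.

Lemma oplus1_entries {k : fieldType} (X : GL k 3) (A : 'M[k]_4) :
  A = oplus1 X ->
  [/\ [/\ A p0 p0 = X o0 o0, A p0 p1 = X o0 o1, A p0 p2 = X o0 o2 & A p0 p3 = 0],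
      [/\ A p1 p0 = X o1 o0, A p1 p1 = X o1 o1, A p1 p2 = X o1 o2 & A p1 p3 = 0],
      [/\ A p2 p0 = X o2 o0, A p2 p1 = X o2 o1, A p2 p2 = X o2 o2 & A p2 p3 = 0]
    & [/\ A p3 p0 = 0, A p3 p1 = 0, A p3 p2 = 0 & A p3 p3 = 1]].
Proof.
move=> /oplus1_block[hX h0 h0' h1]; have [-> -> ->] := ord4_shift.
by split; split; rewrite ?hX ?h0 ?h0' ?h1.
Qed.

Lemma form_pullback_oplus1 {k : fieldType} (X : GL k 3) :
  let L i : {mpoly k[4]} :=
    (X i o0)%:MP * 'X_p0 + (X i o1)%:MP * 'X_p1 + (X i o2)%:MP * 'X_p2 in
  form_pullback (oplus1 X : 'M_4) (klein_quartic_surface k) =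
    klein (L o0) (L o1) (L o2) + 'X_p3 ^+ 4.
Proof.
move=> L; rewrite form_pullback_klein !sum_ord4.
set A : 'M_4 := gl_mx (oplus1 X).
have [[-> -> -> ->] [-> -> -> ->] [-> -> -> ->] [-> -> -> ->]] :=
  oplus1_entries X A erefl.
by rewrite !scale0r scale1r !addr0 !add0r /L !mul_mpolyC.
Qed.

Lemma klein_quartic_surfaceE (k : fieldType) :
  klein_quartic_surface k = klein 'X_p0 'X_p1 'X_p2 + 'X_p3 ^+ 4.
Proof. by []. Qed.

Lemma cyclotomic7 {F : fieldType} (e : F) : 7.-primitive_root e ->
  1 + e + e ^+ 2 + e ^+ 3 + e ^+ 4 + e ^+ 5 + e ^+ 6 = 0.
Proof.
move=> e7; have e1 : e - 1 != 0.
  rewrite subr_eq0; apply/eqP => e1.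
  by have := eq_prim_root_expr e7 1 0; rewrite expr1 expr0 e1 eqxx.
apply: (mulfI e1); rewrite mulr0.
transitivity (e ^+ 7 - 1); first by ring.
by rewrite (prim_expr_order e7) subrr.
Qed.

Lemma multiplicative1 {G H : groupType} (f : {multiplicative G -> H}) :
  f 1%g = 1%g.
Proof. by apply: (mulgI (f 1%g)); rewrite -gmulfM !mulg1. Qed.

(** Invariance passes to products, so it is enough to check the three generators. *)
Lemma form_pullback_Psi1 {k : closedFieldType} (e : k)
    (Psi : {multiplicative PSL27 -> GL k 3}) (u : PSL27) :
  7.-primitive_root e -> 7%:R != 0 :> k -> is_Psi e Psi ->
  form_pullback (Psi1 Psi u : 'M_4) (klein_quartic_surface k) =
    klein_quartic_surface k.
Proof.
move=> e7 n7 [ha hb hc].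
have cyc := cyclotomic7 e e7.
elim/psl27_generated: u => [u v hu hv||||].
- have -> : (Psi1 Psi (u * v)%g : 'M_4) = Psi1 Psi u *m Psi1 Psi v.
    rewrite /Psi1 /= gmulfM /=.
    rewrite [RHS](mulmx_block (Psi u : 'M_3) 0 0 1%:M (Psi v : 'M_3) 0 0 1%:M).
    by rewrite !(mulmx0, mul0mx, addr0, add0r, mulmx1).
  by rewrite form_pullback_mul hu hv.
- rewrite /Psi1 multiplicative1 /=.
  by rewrite -[block_mx _ _ _ _]scalar_mx_block form_pullback1.
- rewrite /Psi1 form_pullback_oplus1 klein_quartic_surfaceE ha; congr (_ + _).
  rewrite !mxE /= !mul0r !addr0 !add0r !rmorphXn /= /klein.
  (* $A_3$ multiplies the three monomials by [e ^+ 14], [e ^+ 7] and [e ^+ 7]. *)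
  have e7P : (e%:MP : {mpoly k[4]}) ^+ 7 = 1.
    by rewrite -rmorphXn /= (prim_expr_order e7) rmorph1.
  by ring: e7P.
- rewrite /Psi1 form_pullback_oplus1 klein_quartic_surfaceE hb; congr (_ + _).
  rewrite !mxE /= !mul0r !mul1r !addr0 !add0r /klein; ring.
- rewrite /Psi1 form_pullback_oplus1 klein_quartic_surfaceE hc; congr (_ + _).
  rewrite !mxE /= !(rmorphM, rmorphB, rmorphXn) /=.
  apply: klein_C3.
    by rewrite -!rmorphXn -(rmorph1 (@mpolyC 4 k)) -!rmorphD cyc rmorph0.
  transitivity (((sqrtm7 e)^-1 * sqrtm7 e)%:MP : {mpoly k[4]}).
    by rewrite /sqrtm7 !(rmorphM, rmorphD, rmorphN, rmorphXn).
  by rewrite mulVf ?rmorph1 // sqrtm7_neq0.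
Qed.

Lemma D_expE {k : fieldType} {i : k} (i2 : i ^+ 2 = -1) (j : nat) :
  (D i2 ^+ j)%g = diag_of_seq 4 [:: i ^+ j; i ^+ j; i ^+ j; 1] :> 'M_4.
Proof.
elim: j => [|j IHj].
  rewrite expg0 /=; apply/matrixP; apply: ord4P; apply: ord4P;
  by rewrite !mxE.
rewrite expgS /= IHj; apply/matrixP; apply: ord4P; apply: ord4P;
by rewrite !mxE sum_ord4 !mxE /= ?mulr0 ?mul0r ?addr0 ?add0r ?mulr1 -?exprS.
Qed.

Lemma form_pullback_D {k : fieldType} {i : k} (i2 : i ^+ 2 = -1) (j : nat) :
  form_pullback (D i2 ^+ j)%g (klein_quartic_surface k) =
    klein_quartic_surface k.
Proof.
elim: j => [|j IHj]; first by rewrite expg0 form_pullback1.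
rewrite expgS /= form_pullback_mul.
suff -> : form_pullback (D_mx i) (klein_quartic_surface k) =
  klein_quartic_surface k by [].
rewrite form_pullback_klein klein_quartic_surfaceE !sum_ord4 !mxE /=.
rewrite !scale0r !scale1r !addr0 !add0r -!mul_mpolyC /klein.
have iP : (i%:MP : {mpoly k[4]}) ^+ 2 = -1.
  by rewrite -rmorphXn /= i2 rmorphN rmorph1.
by ring: iP.
Qed.

(** * Assembling the group *)

Lemma surfacev_col_mx {k : fieldType} (w : 'cV[k]_3) (s : 'cV[k]_1) :
  surfacev (col_mx w s : 'cV_(3 + 1)) = kleinv w + s 0 0 ^+ 4.
Proof.
have [q0 q1 q2] := ord4_shift.
have q3 : p3 = rshift 3 ord0 :> 'I_(3 + 1) by apply: val_inj.
have e0 : col_mx w s p0 0 = w o0 0 by rewrite q0 col_mxEu.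
have e1 : col_mx w s p1 0 = w o1 0 by rewrite q1 col_mxEu.
have e2 : col_mx w s p2 0 = w o2 0 by rewrite q2 col_mxEu.
have e3 : col_mx w s p3 0 = s 0 0 by rewrite q3 col_mxEd.
by rewrite /surfacev e0 e1 e2 e3.
Qed.

Lemma fixes_klein_Psi {k : closedFieldType} (e : k)
    (Psi : {multiplicative PSL27 -> GL k 3}) (u : PSL27) :
  7.-primitive_root e -> 7%:R != 0 :> k -> is_Psi e Psi ->
  fixes_klein (Psi u : 'M_3).
Proof.
move=> e7 n7 PsiE v.
have := surfacev_pullback (Psi1 Psi u : 'M_4) 1 (col_mx v 0 : 'cV_(3 + 1)).
rewrite scale1r mul1r => /(_ (form_pullback_Psi1 e Psi u e7 n7 PsiE)).
rewrite [X in surfacev X](mul_block_col (Psi u : 'M_3) 0 0 1%:M v 0).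
rewrite !(mulmx0, mul0mx, addr0).
by rewrite !surfacev_col_mx mxE expr0n !addr0.
Qed.

Lemma A3_expE {k : closedFieldType} (e : k)
    (Psi : {multiplicative PSL27 -> GL k 3}) (m : nat) :
  is_Psi e Psi ->
  Psi (psl_a ^+ m)%g =
    diag_of_seq 3 [:: (e ^+ 4) ^+ m; (e ^+ 2) ^+ m; e ^+ m] :> 'M_3.
Proof.
move=> [ha _ _]; elim: m => [|m IHm].
  rewrite expg0 multiplicative1 /=; apply/matrixP; apply: ord3P; apply: ord3P;
  by rewrite !mxE.
rewrite expgS gmulfM /= IHm ha; apply/matrixP; apply: ord3P; apply: ord3P;
by rewrite !mxE sum_ord3 !mxE /= ?mulr0 ?mul0r ?addr0 ?add0r -?exprS.
Qed.

Lemma mul_diag3_col {R : comNzRingType} (a b c x y z : R) :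
  diag_of_seq 3 [:: a; b; c] *m vec3 x y z = vec3 (a * x) (b * y) (c * z).
Proof.
apply/matrixP => i j; rewrite !ord1; move: i; apply: ord3P;
by rewrite !mxE sum_ord3 !mxE /= ?mul0r ?mulr0 ?addr0 ?add0r.
Qed.

Lemma mul_B3_col {k : fieldType} (x y z : k) :
  B3 k *m vec3 x y z = vec3 y z x.
Proof.
apply/matrixP => i j; rewrite !ord1; move: i; apply: ord3P;
by rewrite !mxE sum_ord3 !mxE /= ?mul0r ?mul1r ?addr0 ?add0r.
Qed.

(** Powers of $B_3$ move (1,0,0) to the other coordinate points. $C_3$ moves it to a multiple of
    [(a, b, c)], whose entries $B_3$ permutes cyclically, and $A_3$ sweeps out the orbits of
    seven. *)
Lemma flex_Psi_orbit {k : closedFieldType} (e : k)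
    (Psi : {multiplicative PSL27 -> GL k 3}) (x y z : k) :
  7.-primitive_root e -> 7%:R != 0 :> k -> is_Psi e Psi ->
  klein x y z = 0 -> klein_hessian x y z = 0 ->
  exists u l, vec3 x y z = l *: (Psi u *m vec3 1 0 0).
Proof.
move=> e7 n7 PsiE fP hP; have [_ hb hc] := PsiE.
have scale_vec3 l a b c : l *: vec3 a b c = vec3 (l * a) (l * b) (l * c) :> 'cV[k]_3.
  by apply/matrixP => r ?; rewrite !mxE; case: r => -[|[|[|//]]].
have cyc := cyclotomic7 e e7.
have s0 : (sqrtm7 e)^-1 != 0 by rewrite invr_eq0 sqrtm7_neq0.
set d := (sqrtm7 e)^-1 in s0.
pose a := e - e ^+ 6; pose b := e ^+ 2 - e ^+ 5; pose c := e ^+ 4 - e ^+ 3.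
have Cc : Psi psl_c *m vec3 1 0 0 = d *: vec3 a b c :> 'cV_3.
  rewrite hc; apply/matrixP => i j; rewrite !ord1; move: i; apply: ord3P;
  by rewrite !mxE sum_ord3 !mxE /= !mulr0 !mulr1 !addr0.
have [[-> ->]|[-> ->]|[-> ->]|[l [m]]] := klein_flexP e x y z e7 n7 cyc fP hP.
- exists 1%g, x; rewrite multiplicative1 /= mul1mx scale_vec3.
  by rewrite mulr1 mulr0.
- exists (psl_b * psl_b)%g, y.
  by rewrite gmulfM /= hb -mulmxA !mul_B3_col scale_vec3 mulr1 mulr0.
- by exists psl_b, z; rewrite hb mul_B3_col scale_vec3 mulr1 mulr0.
case=> -[-> -> ->].
- exists (psl_a ^+ m * psl_c)%g, (l / d).
  rewrite gmulfM /= -mulmxA Cc (A3_expE e) // -scalemxAr scalerA divfK //.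
  by rewrite mul_diag3_col scale_vec3.
- exists (psl_a ^+ m * (psl_b * psl_c))%g, (l / d).
  rewrite !gmulfM /= -!mulmxA Cc (A3_expE e) // hb -!scalemxAr scalerA divfK //.
  by rewrite mul_B3_col mul_diag3_col scale_vec3.
- exists (psl_a ^+ m * (psl_b * (psl_b * psl_c)))%g, (l / d).
  rewrite !gmulfM /= -!mulmxA Cc (A3_expE e) // hb -!scalemxAr scalerA divfK //.
  by rewrite !mul_B3_col mul_diag3_col scale_vec3.
Qed.

Lemma fixes_klein_PSL {k : closedFieldType} (e i : k)
    (Psi : {multiplicative PSL27 -> GL k 3}) (X : 'M[k]_3) :
  [pchar k] =i pred0 -> 7.-primitive_root e -> i ^+ 2 = -1 -> is_Psi e Psi ->
  X \in unitmx -> fixes_klein X ->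
  exists (u : PSL27) (j : 'I_4), X = i ^+ j *: (Psi u : 'M_3).
Proof.
move=> char0 e7 i2 PsiE uX hX.
have nat0 n : (n%:R == 0 :> k) = (n == 0%N) by move/pcharf0P: char0; apply.
have n6 : 6%:R != 0 :> k by rewrite nat0.
have n7 : 7%:R != 0 :> k by rewrite nat0.
have n12 : 12%:R != 0 :> k by rewrite nat0.
have [fP hP] := fixes_klein_flex X n6 uX hX.
have [u [l uP]] := flex_Psi_orbit e Psi _ _ _ e7 n7 PsiE fP hP.
have XE (M : 'M[k]_3) : M *m vec3 1 0 0 = vec3 (M o0 o0) (M o1 o0) (M o2 o0).
  apply/matrixP => r c; rewrite !ord1; move: r; apply: ord3P;
  by rewrite !mxE sum_ord3 !mxE /= mulr1 !mulr0 !addr0.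
(* Composing with the inverse of [Psi u] brings the flex back to (1,0,0), up to a scalar. *)
set h := Psi u in uP; set Y := invmx h *m X.
have hE : h *m Y = X by rewrite mulKVmx ?gl_unit.
have uY : Y \in unitmx by rewrite unitmx_mul unitmx_inv gl_unit.
have hY : fixes_klein Y.
  by move=> v; rewrite -(fixes_klein_Psi e Psi u e7 n7 PsiE) mulmxA hE hX.
have : Y *m vec3 1 0 0 = l *: vec3 1 0 0.
  by rewrite -mulmxA XE uP -scalemxAr mulmxA mulVmx ?gl_unit // mul1mx.
rewrite XE => /matrixP Yl.
have Y1 : Y o1 o0 = 0 by have := Yl o1 0; rewrite !mxE /= mulr0.
have Y2 : Y o2 o0 = 0 by have := Yl o2 0; rewrite !mxE /= mulr0.
have [t t28 YE] := fixes_klein_diag Y n12 uY hY Y1 Y2.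
have [j [m tE]] := root_unity28 e i t e7 i2 t28.
exists (u * psl_a ^+ m)%g, j.
rewrite gmulfM /= (A3_expE e) // -hE scalemxAr -/h; congr (_ *m _).
have i4 : i ^+ 4 = 1 by rewrite (exprM i 2 2) i2 sqrrN expr1n.
have ij4 : (i ^+ j) ^+ 4 = 1 by rewrite exprAC i4 expr1n.
have em7 : (e ^+ m) ^+ 7 = 1 by rewrite exprAC (prim_expr_order e7) expr1n.
rewrite YE tE; move: ij4 em7; rewrite ![(e ^+ _) ^+ m]exprAC.
move: (i ^+ j) (e ^+ m) => I E I4 E7.
(* The exponents reduce by 25 = 9 = 1 modulo 4, and by 100 = 2 and 36 = 1 modulo 7; thus [Y] is [I]
   times a power of $A_3$. *)
have E2 : (I * E ^+ 4) ^+ 25 = I * E ^+ 2 by ring: I4 E7.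
have E1 : (I * E ^+ 4) ^+ 9 = I * E by ring: I4 E7.
rewrite E1 E2; apply/matrixP; apply: ord3P; apply: ord3P;
by rewrite !mxE /= ?mulr0.
Qed.

Lemma stabiliser_klein_quartic_surface {k : closedFieldType} (e i : k)
    (Psi : {multiplicative PSL27 -> GL k 3}) (A : 'M[k]_4) (c : k)
    (i2 : i ^+ 2 = -1) :
  [pchar k] =i pred0 -> 7.-primitive_root e -> is_Psi e Psi ->
  A \in unitmx -> c != 0 ->
  form_pullback A (klein_quartic_surface k) = c *: klein_quartic_surface k ->
  exists (u : PSL27) (j : 'I_4),
    exists2 d : k, d != 0 & A = d *: ((Psi1 Psi u * D i2 ^+ j)%g : 'M_4).
Proof.
move=> char0 e7 PsiE uA c0 hA.
have nat0 n : (n%:R == 0 :> k) = (n == 0%N) by move/pcharf0P: char0; apply.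
have n12 : 12%:R != 0 :> k by rewrite nat0.
have sA v := surfacev_pullback A c v hA.
have [[A03 A13 A23] [A30 A31 A32]] :=
  surface_semi_invariant_block A c n12 uA c0 sA.
have [q0 q1 q2] := ord4_shift.
have q3 : p3 = rshift 3 ord0 :> 'I_(3 + 1) by apply: val_inj.
set d := A p3 p3; pose X := ulsubmx (A : 'M_(3 + 1)).
have AE : A = block_mx X 0 0 d%:M :> 'M_(3 + 1).
  rewrite -[LHS](@submxK _ 3 1 3 1); congr block_mx; apply/matrixP => r s;
    rewrite !ord1 !mxE -?q3.
  - by move: r; apply: ord3P; [rewrite -q0|rewrite -q1|rewrite -q2].
  - by move: s; apply: ord3P; [rewrite -q0|rewrite -q1|rewrite -q2].
  - by [].
have : A \is a GRing.unit by [].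
rewrite -[_ \is a _]/(A \in unitmx) unitmxE.
rewrite (_ : \det A = \det X * d); last first.
  by rewrite [X in \det X]AE (@det_lblock _ 3 1) det_scalar1.
rewrite unitfE mulf_eq0 negb_or => /andP[dX d0].
(* Evaluation at (0,0,0,1) identifies the multiplier, so dividing [A] by [d] makes the form strictly
   invariant. *)
have dc : d ^+ 4 = c.
  have := sA (delta_mx p3 0); rewrite -colE /surfacev /klein !mxE /=.
  by rewrite A03 A13 A23 !expr0n /= !mul0r !addr0 !add0r expr1n mulr1.
have uX : d^-1 *: X \in unitmx by rewrite unitmxZ ?unitfE ?invr_eq0 // unitmxE unitfE.
have hX : fixes_klein (d^-1 *: X).
  move=> v; have := sA (col_mx v 0 : 'cV_(3 + 1)).
  rewrite [X in surfacev (X *m _)]AE.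
  rewrite [X in surfacev X](mul_block_col X 0 0 d%:M v 0).
  rewrite !(mulmx0, mul0mx, addr0).
  rewrite !surfacev_col_mx mxE expr0n !addr0 -dc => h.
  apply: (mulfI (expf_neq0 4 d0)); rewrite -h -scalemxAl.
  move: (X *m v) => w; rewrite /kleinv /klein !mxE; field; exact: d0.
have [u [j uE]] := fixes_klein_PSL e i Psi _ char0 e7 i2 PsiE uX hX.
exists u, j, d => //.
have {}uE : X = d *: (i ^+ j *: (Psi u : 'M_3)).
  by rewrite -uE scalerA divff // scale1r.
pose B : 'M_4 := gl_mx (Psi1 Psi u).
have -> : gl_mx (Psi1 Psi u * D i2 ^+ j)%g = B *m gl_mx (D i2 ^+ j)%g by [].
rewrite [LHS]AE uE D_expE.
have [hB h0 h0' h1] := (oplus1_block (Psi u) B).1 erefl.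
(* Right multiplication by $D^j$ scales the first three columns by [i ^+ j], which supplies the
   scalar in front of [Psi u]. *)
rewrite /diag_of_seq mul_mx_diag.
apply/(@matrixP _ (3 + 1) (3 + 1)) => r s; rewrite [RHS]mxE [in RHS]mxE.
case: (split_ordP r) => {}r ->; case: (split_ordP s) => {}s ->.
- rewrite block_mxEul hB !mxE; congr (_ * _); rewrite mulrC.
  by congr (_ * _); move: s; apply: ord3P.
- by rewrite block_mxEur !ord1 -q3 h0 !mxE mul0r mulr0.
- by rewrite block_mxEdl !ord1 -q3 h0' !mxE mul0r mulr0.
- by rewrite block_mxEdr !ord1 -q3 h1 !mxE /= !mulr1.
Qed.

Theorem proposition4p12 (k : closedFieldType) (char0 : [pchar k] =i pred0)
    (e : k) (e7 : 7.-primitive_root e) (i : k) (i2 : i ^+ 2 = -1)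
    (Psi : {multiplicative PSL27 -> GL k 3})
    (Psi_inj : injective Psi) (PsiE : is_Psi e Psi) :
  (forall x : PGL k 4,
     Paut (klein_quartic_surface k) x <->
     exists (u : PSL27) (j : 'I_4),
       x = pgl_class (Psi1 Psi u * D i2 ^+ j)%g)
  /\
  (forall x : PGL k 4,
     Paut (klein_quartic_surface k) x <->
     generated_subgroup
       (fun y => (exists u : PSL27, y = phi01 Psi u) \/ y = pgl_class (D i2))
       x).
Proof.
set g := klein_quartic_surface k.
have n7 : 7%:R != 0 :> k by move/pcharf0P: char0 => ->.
have gPsi u := form_pullback_Psi1 e Psi u e7 n7 PsiE.
have gD j := form_pullback_D i2 j.
have paut x : Paut g x ->
    exists (u : PSL27) (j : 'I_4), x = pgl_class (Psi1 Psi u * D i2 ^+ j)%g.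
  move=> [A -> [c c0 hA]].
  have [u [j [d d0 AE]]] := stabiliser_klein_quartic_surface
    e i Psi A c i2 char0 e7 PsiE (gl_unit A) c0 hA.
  by exists u, j; apply/eqP/pgl_classP; exists d.
have Paut_fix (A : GL k 4) : form_pullback A g = g -> Paut g (pgl_class A).
  by move=> hA; exists A => //; exists 1; rewrite ?oner_neq0 ?scale1r.
split=> x; first split=> [/paut//|[u [j ->]]].
  by apply: Paut_fix; rewrite [gl_mx _]/= form_pullback_mul gPsi gD.
split=> [/paut[u [j ->]] H [H1 HM _] HS|].
  rewrite gmulfM; apply: (HM); first by apply: HS; left; exists u.
  elim: (j : nat) => [|m IHm]; first by rewrite expg0 multiplicative1.
  by rewrite expgS gmulfM; apply: HM => //; apply: HS; right.
(* Membership in the generated subgroup is applied to [Paut g] itself, which contains the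
   generators; that it is a subgroup is checked last. *)
apply; last first.
  move=> y [[u ->]|->]; first exact/Paut_fix/gPsi.
  by apply: Paut_fix; rewrite -[D i2]expg1 gD.
split.
- exact/Paut_fix/form_pullback1.
- move=> _ _ [A -> [c c0 hA]] [B -> [d d0 hB]].
  exists (A * B)%g; first by rewrite gmulfM.
  exists (c * d); first exact: mulf_neq0.
  by rewrite [gl_mx _]/= form_pullback_mul hA form_pullbackZ hB scalerA.
- move=> _ [A -> [c c0 hA]]; exists (A^-1)%g; first by rewrite pgl_classV.
  exists c^-1; first by rewrite invr_eq0.
  (* Writing [g] as [c^-1] times its pullback by [A] lets the pullback by the inverse cancel. *)
  rewrite -{1}[g](scalerK c0) -hA form_pullbackZ -form_pullback_mul.
  by rewrite [gl_mx _]/= mulmxV ?gl_unit // form_pullback1.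
Qed.
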